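(* Let $X$ and $Y$ be Banach spaces, and let $T\colon X\to Y$ be a weakly compact bounded linear operator. The following are equivalent. (a) $T\in\mathrm{QNA}(X,Y)$. (b) $T^*\in\mathrm{NA}(Y^*,X^* )$. (c) $T^{**}\in\mathrm{NA}(X^{**},Y)$.
   Context: Banach spaces are over $\mathbb{K}=\mathbb{R}$ or $\mathbb{C}$; $B_X$ is the closed unit ball of $X$. $T\in\mathrm{NA}(X,Y)$ if $\|Tx_0\|=\|T\|$ for some $x_0\in B_X$. $T\in\mathrm{QNA}(X,Y)$ if there is $u\in\overline{T(B_X)}$ (norm closure) with $\|u\|=\|T\|$. $T^*$ and $T^{**}$ are the adjoint and biadjoint; since $T$ is weakly compact, $T^{**}(X^{**})\subseteq Y$ (with $Y$ canonically embedded in $Y^{**}$), so $T^{**}$ is regarded as an operator from $X^{**}$ to $Y$. *)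

(* Defs.v *)
From HB Require Import structures.
From mathcomp Require Import all_boot all_order all_algebra.
From mathcomp Require Import all_classical all_reals topology normedtype.
From mathcomp Require Import complex.

Set Implicit Arguments.
Unset Strict Implicit.
Unset Printing Implicit Defensive.

Import Order.TTheory GRing.Theory Num.Theory.
Import numFieldNormedType.Exports.

Local Open Scope classical_set_scope.
Local Open Scope ring_scope.

(* The scalar field is R or C = R[i]. As usual in MathComp-Analysis, norms take
   values in the scalar field; those of a complex space are the nonnegative
   elements of R[i], whose order is partial: x <= y holds when y - x is a
   nonnegative real. *)
Inductive scalars :=
  | RealScalars of realType
  | ComplexScalars of realType.

Definition scalar_field (k : scalars) : numFieldType :=
  match k with
  | RealScalars R => R
  | ComplexScalars R => (R[i])%C
  end.
Coercion scalar_field : scalars >-> numFieldType.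

Lemma norm_supremums (k : scalars) (A : set k) : A !=set0 ->
  (forall a, A a -> 0 <= a) -> ubound A !=set0 -> supremums A !=set0.
Proof.
case: k A => R /= A [a0 Aa0] A0 [M AM].
  have supA : has_sup A by split; [exists a0|exists M].
  exists (sup A); split; first exact: sup_upper_bound.
  by move=> y Ay; apply: ge_sup => //; exists a0.
have reA (a : R[i]) : A a -> a = (complex.Re a)%:C%C.
  by move=> /A0; case: a => a b; rewrite lecE /= => /andP[/eqP -> _].
pose B := [set complex.Re a | a in A].
have leC (x y : R[i]) : x <= y -> complex.Re x <= complex.Re y.
  by rewrite lecE => /andP[].
have supB : has_sup B.
  split; first by exists (complex.Re a0), a0.
  by exists (complex.Re M) => _ [a Aa <-]; exact/leC/AM.
exists ((sup B)%:C%C); split.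
  move=> a Aa; rewrite (reA _ Aa) lecR; apply: sup_upper_bound => //.
  by exists a.
move=> y Ay.
have Iy : complex.Im y = 0.
  by have := Ay _ Aa0; rewrite (reA _ Aa0) lecE /= => /andP[/eqP -> _].
rewrite lecE /= Iy eqxx /=; apply: ge_sup; first by case: supB.
by move=> _ [a Aa <-]; exact/leC/Ay.
Qed.

Definition unit_ball (k : scalars) (X : normedModType k) : set X :=
  [set x | `|x| <= 1].
Arguments unit_ball {k} X.

Definition bounded_ops (k : scalars) (X Y : normedModType k) :
    {pred X -> Y} :=
  [pred f | `[< linear f /\ continuous f >]].
Arguments bounded_ops {k} X Y.

Record bounded_op (k : scalars) (X Y : normedModType k) := BoundedOp {
  op_fun :> X -> Y ;
  op_funP : op_fun \in bounded_ops X Y }.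

Section bounded_op_lmodule.
Context (k : scalars) (X Y : normedModType k).

HB.instance Definition _ := [isSub for @op_fun k X Y].
HB.instance Definition _ := [Choice of bounded_op X Y by <:].

Lemma bounded_ops_submod_closed : submod_closed (bounded_ops X Y).
Proof.
split.
  rewrite inE; split; last by move=> x; exact: cvg_cst.
  by move=> a x y /=; rewrite /GRing.zero /= scaler0 addr0.
move=> a f g; rewrite !inE => -[lf cf] [lg cg].
split.
  move=> b x y; rewrite !fctE lf lg !scalerDr !scalerA (mulrC a b).
  by rewrite addrACA.
move=> x; apply: (@cvgD _ _ _ _ _ (a *: f) g (a *: f x) (g x)); last exact: cg.
by apply: (@cvgZl_tmp _ _ _ _ _ a f (f x)); exact: cf.
Qed.

HB.instance Definition _ :=
  GRing.isSubmodClosed.Build _ _ (bounded_ops X Y)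
    bounded_ops_submod_closed.
HB.instance Definition _ := [SubChoice_isSubLmodule of bounded_op X Y by <:].

Lemma op_linear (T : bounded_op X Y) : linear T.
Proof. by have := op_funP T; rewrite inE => -[]. Qed.

Lemma op_continuous (T : bounded_op X Y) : continuous (T : X -> Y).
Proof. by have := op_funP T; rewrite inE => -[]. Qed.

HB.instance Definition _ (T : bounded_op X Y) :=
  GRing.isLinear.Build k X Y *:%R (op_fun T) (op_linear T).

End bounded_op_lmodule.

Section operator_norm.
Context (k : scalars) (X Y : normedModType k).
Implicit Types T S : bounded_op X Y.

Definition opnorm T : k := supremum 0 [set `|T x| | x in unit_ball X].

Lemma opnormP T : supremums [set `|T x| | x in unit_ball X] (opnorm T).
Proof.
have ne : [set `|T x| | x in unit_ball X] !=set0.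
  by exists `|T 0|, 0 => //; rewrite /unit_ball /= normr0.
rewrite /opnorm /supremum ifF; last by apply/negbTE/set0P.
suff nes : supremums [set `|T x| | x in unit_ball X] !=set0.
  case: xgetP => [//|/= none]; case: nes => y /none[].
apply: (norm_supremums ne); first by move=> _ [x _ <-].
have /linear_boundedP/pinfty_ex_gt0[r r0 Tr] :=
  (linear_bounded_continuous _).2 (@op_continuous _ _ _ T).
exists r => _ [x x1 <-]; apply: le_trans (Tr x) _.
by rewrite -[leRHS]mulr1 ler_wpM2l// ltW.
Qed.

Lemma opnorm_ub T x : `|x| <= 1 -> `|T x| <= opnorm T.
Proof. by move=> x1; apply: (opnormP T).1; exists x. Qed.

Lemma opnorm_le T M : (forall x, `|x| <= 1 -> `|T x| <= M) -> opnorm T <= M.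
Proof. by move=> TM; apply: (opnormP T).2 => _ [x x1 <-]; exact: TM. Qed.

Lemma opnorm_ge0 T : 0 <= opnorm T.
Proof. by rewrite (le_trans _ (@opnorm_ub T 0 _))// normr0. Qed.

Lemma le_opnorm T x : `|T x| <= opnorm T * `|x|.
Proof.
have [->|x0] := eqVneq x 0; first by rewrite linear0 !normr0 mulr0.
have nx : 0 < `|x| by rewrite normr_gt0.
have := @opnorm_ub T (`|x|^-1 *: x).
rewrite linearZ /= !normrZ normfV normr_id mulVf ?gt_eqF// => /(_ (lexx _)).
by rewrite ler_pdivrMl// mulrC.
Qed.

Lemma opnormD T S : opnorm (T + S) <= opnorm T + opnorm S.
Proof.
apply: opnorm_le => x x1; apply: le_trans (ler_normD _ _) _.
by apply: lerD; exact: opnorm_ub.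
Qed.

Lemma opnormZ (a : k) T : opnorm (a *: T) = `|a| * opnorm T.
Proof.
apply/le_anti/andP; split.
  apply: opnorm_le => x x1; rewrite [leLHS]normrZ ler_wpM2l//.
  exact: opnorm_ub.
have [->|a0] := eqVneq a 0; first by rewrite normr0 mul0r opnorm_ge0.
rewrite -ler_pdivlMl ?normr_gt0//; apply: opnorm_le => x x1.
rewrite ler_pdivlMl ?normr_gt0// -normrZ.
exact: (@opnorm_ub (a *: T)).
Qed.

Lemma opnorm0_eq0 T : opnorm T = 0 -> T = 0.
Proof.
move=> T0; apply/val_inj/funext => x /=; apply/eqP.
rewrite -normr_le0 (le_trans (le_opnorm T x))// T0 mul0r//.
Qed.

HB.instance Definition _ := Lmodule_isNormed.Build k (bounded_op X Y)
  opnormD opnormZ opnorm0_eq0.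

Lemma norm_opE T : `|T| = opnorm T. Proof. by []. Qed.

End operator_norm.

Lemma bounded_opsP (k : scalars) (X Y : normedModType k) (f : X -> Y) (M : k) :
  linear f -> 0 <= M -> (forall x, `|f x| <= M * `|x|) ->
  f \in bounded_ops X Y.
Proof.
move=> lf M0 fM; rewrite inE; split => //.
pose g : {linear X -> Y} := HB.pack f (GRing.isLinear.Build _ _ _ _ _ lf).
apply: (@bounded_linear_continuous _ _ _ g); apply/bounded_funP => r.
by exists (M * r) => x xr; apply: le_trans (fM x) _; rewrite ler_wpM2l.
Qed.

Section comp_op.
Context (k : scalars) (X Y Z : normedModType k).

Lemma comp_op_subproof (S : bounded_op Y Z) (T : bounded_op X Y) :
  S \o T \in bounded_ops X Z.
Proof.
apply: (@bounded_opsP _ _ _ _ (opnorm S * opnorm T)); first 1 last.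
- by rewrite mulr_ge0// opnorm_ge0.
- move=> x; rewrite -mulrA (le_trans (le_opnorm S _))// ler_wpM2l ?opnorm_ge0//.
  exact: le_opnorm.
- by move=> a x y /=; rewrite !linearP.
Qed.

Definition comp_op (S : bounded_op Y Z) (T : bounded_op X Y) : bounded_op X Z :=
  BoundedOp (comp_op_subproof S T).

End comp_op.

Notation dual X := (bounded_op X (scalar_field _)^o).

Section adjoint.
Context (k : scalars) (X Y : normedModType k).

Lemma adjoint_subproof (T : bounded_op X Y) :
  (fun f : dual Y => comp_op f T) \in bounded_ops (dual Y) (dual X).
Proof.
apply: (@bounded_opsP _ _ _ _ `|T|) => //.
- by move=> a f g; apply/val_inj/funext.
- move=> f; apply: opnorm_le => x x1 /=.
  rewrite (le_trans (le_opnorm f _))// mulrC ler_wpM2r ?opnorm_ge0//.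
  exact: opnorm_ub.
Qed.

Definition adjoint (T : bounded_op X Y) : bounded_op (dual Y) (dual X) :=
  BoundedOp (adjoint_subproof T).

Lemma canonical_embedding_subproof (y : Y) :
  (fun f : dual Y => f y) \in bounded_ops (dual Y) (scalar_field k)^o.
Proof.
apply: (@bounded_opsP _ _ _ _ `|y|) => //.
by move=> f; rewrite mulrC; exact: le_opnorm.
Qed.

Definition canonical_embedding (y : Y) : dual (dual Y) :=
  BoundedOp (canonical_embedding_subproof y).

End adjoint.

(* The coarsest topology on Y for which every f in the dual of Y is continuous. *)
Definition weak_topology (k : scalars) (Y : normedModType k) :
    topologicalType :=
  sup_topology (fun f : dual Y =>
    Topological.on (initial_topology (f : Y -> (scalar_field k)^o))).

Section classes_of_operators.
Context (k : scalars) (X Y : normedModType k).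
Implicit Type T : bounded_op X Y.

(* precompact A amounts to: the closure of A is compact (precompactE). *)
Definition weakly_compact T : Prop :=
  precompact (T @` unit_ball X : set (weak_topology Y)).

Definition NA T : Prop := exists2 x0, unit_ball X x0 & `|T x0| = `|T|.

Definition QNA T : Prop :=
  exists2 u, closure (T @` unit_ball X) u & `|u| = `|T|.

End classes_of_operators.

(* Main.v *)
Require Import Defs.
From HB Require Import structures.
From mathcomp Require Import all_boot all_order all_algebra.
From mathcomp Require Import all_classical all_reals topology normedtype.
From mathcomp Require Import complex ring lra.

Set Implicit Arguments.
Unset Strict Implicit.
Unset Printing Implicit Defensive.

Import Order.TTheory GRing.Theory Num.Theory.
Import numFieldNormedType.Exports.

Local Open Scope classical_set_scope.
Local Open Scope ring_scope.

(* The Hahn-Banach theorem identifies the norm closure of T(B_X) as the set of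
   the points p with |f p| <= ||T* f|| for every f in Y*. Applied to the
   operators from X to K^n, this is Helly's theorem: on finitely many
   functionals, an element xi of the unit ball of X** is approximated by points of B_X. By
   weak compactness the corresponding points of T(B_X) have a weak cluster
   point, which represents T** xi in Y.
   (a) => (b): a functional norming u satisfies ||T* f|| >= |f u| = ||T||.
   (b) => (c): T** attains its norm at an element of X** norming T* f.
   (c) => (a): the above description of the closure applies to p = T** xi. *)

(** * Hahn-Banach for sublinear functionals on real vector spaces *)

Section sublinear.
Context (R : realType) (V : lmodType R).
Implicit Types (p : V -> R) (x y v : V).

Definition sublinear p :=
  (forall x y, p (x + y) <= p x + p y) /\
  (forall t x, 0 < t -> p (t *: x) <= t * p x).

Lemma sublinearZ p t x : sublinear p -> 0 < t -> p (t *: x) = t * p x.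
Proof.
move=> [_ pZ] t0; apply/le_anti; rewrite pZ//=.
rewrite -ler_pdivlMl//.
have := pZ t^-1 (t *: x).
by rewrite scalerA mulVf ?gt_eqF// scale1r invr_gt0; apply.
Qed.

Lemma sublinear0 p : sublinear p -> p 0 = 0.
Proof.
by move=> /(@sublinearZ _ 2 0)/(_ (ltr0Sn _ 1)); rewrite scaler0; lra.
Qed.

Lemma sublinearN p x : sublinear p -> - p (- x) <= p x.
Proof.
by move=> sp; have := sp.1 x (- x); rewrite subrr (sublinear0 sp); lra.
Qed.

(* The largest sublinear functional [r <= p] such that [r (- x) <= - p x]. *)
Definition ray_inf p x y :=
  inf [set p (y + t *: x) - t * p x | t in [set t | 0 <= t]].

Lemma ray_inf_le p x y t : sublinear p -> 0 <= t ->
  ray_inf p x y <= p (y + t *: x) - t * p x.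
Proof.
move=> sp t0; apply: ge_inf; last by exists t.
exists (- p (- y)) => _ [s /= s0 <-].
have sxE : p (s *: x) = s * p x.
  move: s0; rewrite le_eqVlt => /predU1P[<-|s0]; last exact: sublinearZ.
  by rewrite scale0r mul0r sublinear0.
have := sp.1 (y + s *: x) (- y).
rewrite addrAC subrr add0r sxE; lra.
Qed.

Lemma le_ray_inf p x y m :
  (forall t, 0 <= t -> m <= p (y + t *: x) - t * p x) -> m <= ray_inf p x y.
Proof.
move=> mP; apply: lb_le_inf; last by move=> _ [t /= t0 <-]; exact: mP.
by exists (p (y + 0 *: x) - 0 * p x), 0 => /=.
Qed.

Lemma sublinear_ray_inf p x : sublinear p -> sublinear (ray_inf p x).
Proof.
move=> sp; split.
  move=> y z; rewrite -lerBlDr; apply: le_ray_inf => s s0.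
  rewrite lerBlDr -lerBlDl; apply: le_ray_inf => t t0.
  rewrite lerBlDl; apply: le_trans (ray_inf_le x (y + z) sp (addr_ge0 s0 t0)) _.
  have := sp.1 (y + s *: x) (z + t *: x).
  by rewrite addrACA -scalerDl; lra.
move=> r y r0; rewrite -ler_pdivrMl//; apply: le_ray_inf => t t0.
rewrite ler_pdivrMl//.
apply: le_trans (ray_inf_le x _ sp (mulr_ge0 (ltW r0) t0)) _.
by rewrite -scalerA -scalerDr (sublinearZ _ sp r0) mulrBr mulrA.
Qed.

Lemma ray_inf_le_id p x y : sublinear p -> ray_inf p x y <= p y.
Proof.
move=> sp; apply: le_trans (ray_inf_le x y sp (lexx 0)) _.
by rewrite scale0r addr0 mul0r subr0.
Qed.

(** Minimality gives [ray_inf p y = p]; the value [t = 1] in the infimum then yields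
    [p x <= p (x + y) - p y], the missing half of additivity. *)
Lemma minimal_sublinear_linear p : sublinear p ->
  (forall q, sublinear q -> (forall x, q x <= p x) -> q = p) ->
  linear (p : V -> R^o).
Proof.
move=> sp pmin.
have pD x y : p (x + y) = p x + p y.
  apply/le_anti; rewrite sp.1/=.
  have <- := congr1 (fun q => q x)
    (pmin _ (sublinear_ray_inf y sp) (fun z => ray_inf_le_id y z sp)).
  by have := ray_inf_le y x sp ler01; rewrite scale1r mul1r; lra.
have pN x : p (- x) = - p x.
  by have := pD x (- x); rewrite subrr sublinear0//; lra.
move=> t x y; rewrite pD; congr (_ + _).
have [t0|t0|->] := ltgtP t 0.
- rewrite -[t *: x]opprK -scaleNr pN sublinearZ ?oppr_gt0//.
  by rewrite mulNr opprK.
- exact: sublinearZ.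
- by rewrite !scale0r sublinear0.
Qed.

Theorem hahn_banach_sublinear p v : sublinear p ->
  exists f : {linear V -> R^o}, (forall x, f x <= p x) /\ f v = p v.
Proof.
move=> sp; have sp' := sublinear_ray_inf v sp.
(* Minimizing below [ray_inf p v] instead of [p] forces [f (- v) <= - p v], hence [f v = p v]. *)
pose P (q : V -> R) := sublinear q /\ forall x, q x <= ray_inf p v x.
pose dom := {q | P q}.
(* The order is reversed: a maximal element for [below] is minimal pointwise. *)
pose below (q r : dom) : bool := `[< forall x, sval r x <= sval q x >].
have [|||chain|q qmin] := @Zorn dom below.
- by move=> q; apply/asboolP.
- move=> q r s /asboolP qr /asboolP rs; apply/asboolP => x.
  exact: le_trans (rs x) (qr x).
- move=> [q qP] [r rP] /asboolP/= qr /asboolP/= rq; apply: eq_exist.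
  by apply/funext => x; apply/le_anti; rewrite qr rq.
- move=> Ctot.
  have [[c0 Cc0]|C0] := pselect (chain !=set0); last first.
    have pp : P (ray_inf p v) by split.
    by exists (exist P _ pp) => s Cs; exfalso; apply: C0; exists s.
  (* The pointwise infimum bounds the chain; it is finite because every member is at least
     [- ray_inf p v (- x)] at [x]. *)
  pose m x := inf [set sval c x | c in chain].
  have m_le c x : chain c -> m x <= sval c x.
    move=> Cc; apply: ge_inf; last by exists c.
    exists (- ray_inf p v (- x)) => _ [[d [sd dp]] Cd <-] /=.
    by apply: le_trans (sublinearN x sd); rewrite lerN2.
  have le_inf_m r x : (forall c, chain c -> r <= sval c x) -> r <= m x.
    move=> rP; apply: lb_le_inf; first by exists (sval c0 x), c0.
    by move=> _ [c Cc <-]; exact: rP.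
  have mP : P m.
    split; last by move=> x; exact: le_trans (m_le _ _ Cc0) ((svalP c0).2 x).
    split.
      move=> x y; rewrite -lerBlDr; apply/le_inf_m => c Cc.
      rewrite lerBlDr -lerBlDl; apply/le_inf_m => d Cd.
      (* Subadditivity of the smaller of [c] and [d] bounds [m (x + y)] by [c x + d y]. *)
      rewrite lerBlDl; case: (Ctot c d Cc Cd) => /asboolP cd.
        apply: le_trans (m_le _ _ Cd) _; apply: le_trans ((svalP d).1.1 _ _) _.
        by have := cd x; lra.
      apply: le_trans (m_le _ _ Cc) _; apply: le_trans ((svalP c).1.1 _ _) _.
      by have := cd y; lra.
    move=> t x t0; rewrite -ler_pdivrMl//; apply/le_inf_m => c Cc.
    rewrite ler_pdivrMl//; apply: le_trans (m_le _ _ Cc) _.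
    exact: (svalP c).1.2.
  exists (exist P m mP) => s Cs; apply/asboolP => x /=; exact: m_le.
case: q qmin => q [sq qp] qmin.
have ql : linear (q : V -> R^o).
  apply: minimal_sublinear_linear => // r sr rq.
  have rP : P r.
    by split=> // x; exact: le_trans (rq x) (qp x).
  by have /(congr1 sval) := qmin (exist P r rP) (asboolT rq).
pose f : {linear V -> R^o} :=
  HB.pack (q : V -> R^o) (GRing.isLinear.Build _ _ _ _ _ ql).
have fp x : f x <= p x by exact: le_trans (qp x) (ray_inf_le_id _ _ sp).
exists f; split => //; apply/le_anti; rewrite fp/=.
have := le_trans (qp (- v)) (ray_inf_le v (- v) sp ler01).
have -> : q (- v) = - f v by exact: (raddfN f).
by rewrite scale1r mul1r addNr sublinear0// sub0r lerN2.
Qed.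

End sublinear.

(** * Passage from real to complex functionals *)

(** A separate name for [V] carries the real structure without a clash with the complex one. *)
Definition realification (R : realType) (V : lmodType R[i]%C) : Type := V.

Section realification.
Context (R : realType) (V : lmodType R[i]%C).

HB.instance Definition _ := GRing.Zmodule.on (realification V).

Definition real_scale (t : R) (x : realification V) : realification V :=
  (t%:C%C *: (x : V)).

Lemma real_scaleA a b x : real_scale a (real_scale b x) = real_scale (a * b) x.
Proof. by rewrite /real_scale scalerA rmorphM. Qed.

Lemma real_scale1 : left_id 1 real_scale.
Proof. by move=> x; rewrite /real_scale rmorph1 scale1r. Qed.

Lemma real_scaleDr : right_distributive real_scale +%R.
Proof. by move=> a x y; rewrite /real_scale scalerDr. Qed.

Lemma real_scaleDl x : {morph real_scale^~ x : a b / a + b}.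
Proof. by move=> a b; rewrite /real_scale rmorphD scalerDl. Qed.

HB.instance Definition _ := GRing.Zmodule_isLmodule.Build R (realification V)
  real_scaleA real_scale1 real_scaleDr real_scaleDl.

End realification.

Section complexification.
Context (R : realType) (V : lmodType R[i]%C).
Context (g : {linear realification V -> R^o}).

(** This is [g x - i g (i x)], the complex-linear functional with real part [g]. *)
Definition complexify (x : V) : (R[i]%C)^o := Complex (g x) (- g ('i%C *: x)).

Lemma complexify_linear : linear complexify.
Proof.
have gZ (t : R) (x : V) : g (t%:C%C *: x) = t * g x.
  by exact: (linearZZ g t (x : realification V)).
have gD (x y : V) : g (x + y) = g x + g y by exact: (raddfD g x y).
have gE (b c : R) (x : V) :
    g (Complex b c *: x) = b * g x + c * g ('i%C *: x).
  rewrite -!gZ -gD scalerA -scalerDl.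
  suff -> : b%:C%C + c%:C%C * 'i%C = Complex b c by [].
  by apply/eqP; rewrite eq_complex /=; apply/andP; split; apply/eqP; ring.
move=> [b c] x y; rewrite /complexify scalerDr !gD scalerA (gE b c).
have -> : 'i%C * Complex b c = Complex (- c) b.
  by apply/eqP; rewrite eq_complex /=; apply/andP; split; apply/eqP; ring.
rewrite (gE (- c) b).
apply/eqP; rewrite eq_complex /=; apply/andP; split; apply/eqP; ring.
Qed.

HB.instance Definition _ :=
  GRing.isLinear.Build R[i]%C V (R[i]%C)^o *:%R complexify complexify_linear.

(** Multiplying [x] by the unimodular scalar [|z| / z] leaves [q] unchanged and makes the value
    equal to [|z|], hence equal to its real part, which [g] computes. *)
Lemma normc_complexify_le (q : V -> R[i]%C) :
  (forall x, 0 <= q x) -> (forall a x, q (a *: x) = `|a| * q x) ->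
  (forall x, g x <= complex.Re (q x)) -> forall x, `|complexify x| <= q x.
Proof.
move=> q0 qZ gq x; have [->|z0] := eqVneq (complexify x) 0.
  by rewrite normr0 q0.
set z := complexify x in z0 *.
have nz0 : `|z| != 0 by rewrite normr_eq0.
have := gq ((`|z| / z) *: x).
rewrite qZ normf_div normr_id divff// mul1r.
have : complexify ((`|z| / z) *: x) = `|z|.
  by rewrite linearZ/= -/z; change (`|z| / z * z = `|z|); rewrite divfK.
move=> /(congr1 (@complex.Re R)) /= -> zq.
have realE (c : R[i]%C) : 0 <= c -> c = (complex.Re c)%:C%C.
  by case: c => a b; rewrite lecE /= => /andP[/eqP -> _].
by rewrite (realE _ (normr_ge0 z)) (realE _ (q0 x)) lecR.
Qed.

End complexification.

Theorem hahn_banach (k : scalars) (V : lmodType k) (q : V -> k) (v : V) :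
  (forall x, 0 <= q x) -> (forall x y, q (x + y) <= q x + q y) ->
  (forall a x, q (a *: x) = `|a| * q x) ->
  exists f : {linear V -> (scalar_field k)^o},
    (forall x, `|f x| <= q x) /\ f v = q v.
Proof.
case: k V q v => R V q v q0 qD qZ.
  have sq : @sublinear R V q.
    by split=> // t x t0; rewrite qZ gtr0_norm.
  have [f [fq fv]] := hahn_banach_sublinear v sq.
  exists f; split=> // x; rewrite ler_norml fq andbT lerNl.
  have := fq (- x); rewrite raddfN => /le_trans; apply.
  by rewrite -scaleN1r qZ normrN normr1 mul1r.
have sq : @sublinear R (realification V) (fun x => complex.Re (q x)).
  split.
    by move=> x y; have := qD x y; rewrite lecE => /andP[_]; rewrite raddfD.
  move=> t x t0; rewrite /GRing.scale/= /real_scale qZ.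
  have -> : `|t%:C%C| = t%:C%C :> R[i]%C by rewrite gtr0_norm// ltcR.
  by case: (q x) => a b /=; rewrite mul0r subr0.
have [g [gq gv]] := hahn_banach_sublinear (v : realification V) sq.
have fq := normc_complexify_le q0 qZ gq.
exists (complexify g); split=> //.
(* The value at [v] has real part [q v] and modulus at most [q v], so its imaginary part [b]
   vanishes. *)
have [a a0 qa] : exists2 a, 0 <= a & q v = a%:C%C.
  have := q0 v; case: (q v) => a b; rewrite lecE /= => /andP[/eqP -> a0].
  by exists a.
pose b := - g ('i%C *: v).
have zE : complexify g v = Complex a b by rewrite /complexify gv qa.
move: (fq v); rewrite zE qa normc_def /= lecR => ab.

have : Num.sqrt (a ^+ 2 + b ^+ 2) ^+ 2 <= a ^+ 2.
  by rewrite ler_sqr ?nnegrE ?sqrtr_ge0.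
rewrite sqr_sqrtr ?addr_ge0 ?sqr_ge0// gerDl => b2.
have /eqP : b ^+ 2 = 0 by apply/le_anti; rewrite b2 sqr_ge0.
by rewrite sqrf_eq0 => /eqP b0; rewrite [LHS]zE b0.
Qed.

(** * The norm closure of the image of the unit ball *)

(** The infimum is the supremum of the nonnegative lower bounds, which exists over both fields by
    [norm_supremums]; a nonpositive [b] lies below it since [0 <= m]. *)
Lemma norm_infimum (k : scalars) (A : set k) : A !=set0 ->
  (forall a, A a -> 0 <= a) ->
  exists m, [/\ 0 <= m, lbound A m &
    forall b, b \is Num.real -> lbound A b -> b <= m].
Proof.
move=> [a0 Aa0] A0.
have [|||m [mub mlub]] := @norm_supremums k [set b | 0 <= b /\ lbound A b].
- by exists 0; split.
- by move=> b [].
- by exists a0 => b [_]; apply.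
have m0 : 0 <= m by apply: mub; split.
exists m; split => //.
  by move=> a Aa; apply: mlub => b [_]; apply.
move=> b; rewrite realE => /orP[b0 Ab|b0 _]; first exact: mub.
exact: le_trans b0 m0.
Qed.

Lemma norming_functional (k : scalars) (Y : normedModType k) (y : Y) :
  exists f : dual Y, `|f| <= 1 /\ f y = `|y|.
Proof.
have [|||f [fy fyy]] := @hahn_banach k Y (fun z => `|z|) y.
- by move=> x; exact: normr_ge0.
- exact: ler_normD.
- by move=> a x; rewrite normrZ.
have fb : (f : Y -> (scalar_field k)^o) \in bounded_ops Y (scalar_field k)^o.
  apply: (@bounded_opsP _ _ _ _ 1) => //; first exact: linearP.
  by move=> x; rewrite mul1r.
exists (BoundedOp fb); split=> //.
by apply: opnorm_le => x /= x1; exact: le_trans (fy x) x1.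
Qed.

Lemma le_adjoint (k : scalars) (X Y : normedModType k) (T : bounded_op X Y) :
  `|adjoint T| <= `|T|.
Proof.
apply: opnorm_le => f f1; apply: opnorm_le => x x1 /=.
apply: le_trans (le_opnorm f _) _; rewrite -[leRHS]mul1r.
by apply: ler_pM => //; [exact: opnorm_ge0|exact: opnorm_ub].
Qed.

(* Quotient seminorm of [X x Y -> Y, (x, z) |-> T x + z] for the norm
   [`|x| + s * `|z|]. *)
Lemma infimal_convolution (k : scalars) (X Y : normedModType k)
    (T : bounded_op X Y) (s : k) : 0 <= s ->
  exists q : Y -> k, [/\ forall z, 0 <= q z,
    forall z w, q (z + w) <= q z + q w,
    forall a z, q (a *: z) = `|a| * q z,
    forall x z, q z <= `|x| + s * `|z - T x| &
    forall m z, m \is Num.real ->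
      (forall x, m <= `|x| + s * `|z - T x|) -> m <= q z].
Proof.
move=> s0; pose A z := [set `|x| + s * `|z - T x| | x in setT].
have A0 z a : A z a -> 0 <= a.
  by move=> [x _ <-]; rewrite addr_ge0// mulr_ge0.
have [z|q qP] := choice (fun z => norm_infimum _ (A0 z)).
  by exists (`|0 : X| + s * `|z - T 0|), 0.
have q0 z : 0 <= q z by have [] := qP z.
have q_le x z : q z <= `|x| + s * `|z - T x|.
  by have [_ + _] := qP z; apply; exists x.
have le_q m z : m \is Num.real ->
    (forall x, m <= `|x| + s * `|z - T x|) -> m <= q z.
  by move=> mr mP; have [_ _] := qP z; apply=> // _ [x _ <-].
have qreal z : q z \is Num.real by exact: ger0_real.
have nreal x z : `|x| + s * `|z - T x| \is Num.real.
  by apply: ger0_real; rewrite addr_ge0// mulr_ge0.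
exists q; split=> //.
  move=> z w; rewrite -lerBlDr; apply/le_q; first exact: realB.
  move=> x; rewrite lerBlDr -lerBlDl; apply/le_q; first exact: realB.
  move=> y; rewrite lerBlDl; apply: le_trans (q_le (x + y) _) _.
  rewrite addrACA -mulrDr lerD ?ler_normD// ler_wpM2l//.
  by rewrite raddfD opprD addrACA ler_normD.
have qZ a z : q (a *: z) <= `|a| * q z.
  have [->|a0] := eqVneq a 0.
    rewrite normr0 mul0r scale0r; apply: le_trans (q_le 0 0) _.
    by rewrite raddf0 subr0 !normr0 mulr0 addr0.
  have na0 : 0 < `|a| by rewrite normr_gt0.
  rewrite -ler_pdivrMl//; apply: le_q.
    by rewrite realM// realV normr_real.
  move=> x; rewrite ler_pdivrMl//; apply: le_trans (q_le (a *: x) _) _.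
  by rewrite linearZ/= -scalerBr !normrZ mulrDr mulrCA.
move=> a z; apply/le_anti; rewrite qZ/=.
have [->|a0] := eqVneq a 0; first by rewrite normr0 mul0r.
(* The reverse inequality is [qZ] for the scalar [a^-1]. *)
rewrite -ler_pdivlMl ?normr_gt0// -normfV.
by apply: le_trans (qZ _ _); rewrite scalerA mulVf// scale1r.
Qed.

(** If no point of the ball were mapped close to [p], Hahn-Banach for the seminorm [q] of
    [infimal_convolution] would give [f] with [|T* f| <= 1 < |f p|]. *)
Lemma closure_image_ball (k : scalars) (X Y : normedModType k)
    (T : bounded_op X Y) (p : Y) :
  (forall f : dual Y, `|f p| <= `|adjoint T f|) ->
  closure (T @` unit_ball X) p.
Proof.
move=> pT.
suff near_p e : 0 < e -> exists2 x, `|x| <= 1 & `|p - T x| < e.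
  move=> B /nbhs_ballP[e /= e0 eB]; have [x x1 xe] := near_p e e0.
  by exists (T x); split; [exists x|apply: eB; rewrite -ball_normE].
move=> e0; pose M := opnorm T; have M0 : 0 <= M by exact: opnorm_ge0.
have M1 : 0 < M + 1 by rewrite ltr_wpDl.
(* Shrinking a vector of norm at most [1 + d] into the unit ball moves its image by at most
   [M * d <= e / 2]; [M + 1] keeps the denominator positive when [T = 0]. *)
pose d := e / 2 / (M + 1); have d0 : 0 < d by rewrite !divr_gt0.
have d1 : 0 < 1 + d by rewrite addr_gt0.
(* With this weight, [s * |p - T x| < 1 + d] says that [|p - T x| < e / 2]. *)
pose s := (1 + d) / (e / 2); have s0 : 0 < s by rewrite !divr_gt0.
have [q [q0 qD qZ q_le le_q]] := infimal_convolution T (ltW s0).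
have [x xd] : exists x, `|x| + s * `|p - T x| < 1 + d.
  apply/not_existsP => no_x.
  have qp : 1 + d <= q p.
    apply: le_q => [|x]; first exact/ger0_real/ltW.
    rewrite real_leNgt; first exact/negP/no_x.
      exact/ger0_real/ltW.
    by rewrite ger0_real// addr_ge0// mulr_ge0// ltW.
  have [f [fq fp]] := hahn_banach p q0 qD qZ.
  (* Taking [x = 0] in the infimum bounds [q z] by [s * |z|], so [f] is continuous. *)
  have fb : (f : Y -> (scalar_field k)^o) \in bounded_ops Y (scalar_field k)^o.
    apply: (@bounded_opsP _ _ _ _ s); [exact: linearP|exact: ltW|].
    move=> z; apply: le_trans (fq z) _; apply: le_trans (q_le 0 z) _.
    by rewrite normr0 add0r raddf0 subr0.
  (* Taking [x] itself in the infimum at [T x] gives [|f (T x)| <= |x|], while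
     [f p = q p >= 1 + d]. *)
  have : `|adjoint T (BoundedOp fb)| <= 1.
    apply: opnorm_le => x x1; apply: le_trans (fq _) _.
    apply: le_trans (q_le x _) _.
    by rewrite subrr normr0 mulr0 addr0.
  move/(le_trans (pT _)) => /=; rewrite fp ger0_norm// => /(le_trans qp).
  by rewrite gerDl lt_geF.
have xd' : `|x| <= 1 + d.
  by apply: le_trans (ltW xd); rewrite lerDl mulr_ge0// ltW.
exists ((1 + d)^-1 *: x).
  by rewrite normrZ normfV gtr0_norm// ler_pdivrMl// mulr1.
have -> : p - T ((1 + d)^-1 *: x) = (p - T x) + T ((d / (1 + d)) *: x).
  have -> : d / (1 + d) = 1 - (1 + d)^-1.
    apply: (mulIf (lt0r_neq0 d1)).
    by rewrite mulrBl mul1r divfK ?mulVf ?gt_eqF// addrAC subrr add0r.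
  by rewrite scalerBl scale1r raddfB addrA subrK.
apply: le_lt_trans (ler_normD _ _) _.
rewrite (splitr e) ltr_leD//.
  rewrite -(ltr_pM2l s0); apply: le_lt_trans _ (lt_le_trans xd _).
    by rewrite lerDr.
  by rewrite /s divfK// gt_eqF// divr_gt0.
apply: le_trans (le_opnorm T _) _; rewrite normrZ normf_div !gtr0_norm//.
rewrite -mulrA [X in d * X]mulrC.
apply: le_trans (_ : M * d <= _).
  by rewrite ler_wpM2l// ler_piMr ?(ltW d0)// ler_pdivrMr// mul1r.
rewrite /d mulrCA ler_piMr//; first by rewrite divr_ge0// ltW.
by rewrite ler_pdivrMr// mul1r lerDl.
Qed.

(** * Helly's theorem *)

(** [closure_image_ball] applies to the operator [G] with coordinates [g i]: a functional [F] on
    rows satisfies [F p = xi (G* F)], of modulus at most [|G* F|]. *)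
Lemma helly (k : scalars) (X : normedModType k) (xi : dual (dual X))
    (n : nat) (g : 'I_n.+1 -> dual X) (e : k) : `|xi| <= 1 -> 0 < e ->
  exists2 x, `|x| <= 1 & forall i, `|xi (g i) - g i x| < e.
Proof.
move=> xi1 e0; pose G (x : X) : 'rV[k]_n.+1 := \row_i (g i x : k).
have Gb : G \in bounded_ops X 'rV[k]_n.+1.
  apply: (@bounded_opsP _ _ _ _ (\sum_i opnorm (g i))).
  - by move=> a x y; apply/rowP => i; rewrite !mxE linearP.
  - by rewrite sumr_ge0// => i _; exact: opnorm_ge0.
  - move=> x.
    have [Gx0|/mx_norm_neq0[[i j] /= Gxij]] := eqVneq (mx_norm (G x)) 0.
      rewrite [leLHS]Gx0 mulr_ge0// sumr_ge0// => i _; exact: opnorm_ge0.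
    rewrite [leLHS]Gxij mxE; apply: le_trans (le_opnorm _ _) _.
    rewrite ler_wpM2r// (bigD1 j)//= lerDl sumr_ge0// => l _.
    exact: opnorm_ge0.
pose p : 'rV[k]_n.+1 := \row_i (xi (g i) : k).
have GP : closure (BoundedOp Gb @` unit_ball X) p.
  apply: closure_image_ball => F.
  have FE : adjoint (BoundedOp Gb) F = \sum_i F (delta_mx 0 i) *: g i.
    apply/val_inj/funext => x.
    (* Writing the right side as an evaluation at [x] lets linearity pass through the sum of
       functionals. *)
    change (F (G x) = canonical_embedding x (\sum_i F (delta_mx 0 i) *: g i)).
    rewrite [G x]row_sum_delta !linear_sum; apply: eq_bigr => i _.
    by rewrite !linearZ/= mxE; exact: mulrC.
  have -> : F p = xi (adjoint (BoundedOp Gb) F).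
    rewrite FE [p]row_sum_delta !linear_sum; apply: eq_bigr => i _.
    by rewrite !linearZ/= mxE; exact: mulrC.
  by rewrite (le_trans (le_opnorm _ _))// ler_piMl.
have [_ [[x x1 <-] px]] := GP _ (nbhsx_ballx p _ e0).
exists x => // i.
case: px => _ /(_ 0 i).
by rewrite -ball_normE /= !mxE.
Qed.

(** * The biadjoint of a weakly compact operator *)

Lemma weak_continuous (k : scalars) (Y : normedModType k) (f : dual Y) :
  continuous (f : weak_topology Y -> (scalar_field k)^o).
Proof.
move=> y.
have /cvg_sup/(_ f) fy : nbhs (y : weak_topology Y) --> (y : weak_topology Y).
  by [].
apply: cvg_trans; last exact: (@initial_continuous _ _ (f : Y -> _) y).
exact: cvg_app.
Qed.

Lemma biadjoint_in_range (k : scalars) (X Y : normedModType k)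
    (T : bounded_op X Y) (xi : dual (dual X)) :
  weakly_compact T -> `|xi| <= 1 ->
  exists y, canonical_embedding y = adjoint (adjoint T) xi.
Proof.
move=> [K TK [Kc _]] xi1.
(* A basic set consists of the [T x] with [x] in the ball and [f (T x)] within 1 of [xi (T* f)] for
   the finitely many [f] in [s]; rescaling [f] gives any other tolerance. *)
pose F : set_system (weak_topology Y) := [set P | exists s : seq (dual Y),
  forall x, `|x| <= 1 ->
    (forall f, f \in s -> `|xi (adjoint T f) - f (T x)| < 1) -> P (T x)].
have FF : ProperFilter F.
  apply: Build_ProperFilter_ex.
    move=> P [s sP].
    (* The extra last index reads the default functional 0, so that Helly's theorem also covers an
       empty list. *)
    pose g (i : 'I_(size s).+1) := adjoint T (nth 0 s i).
    have [x x1 gx] := helly g xi1 ltr01.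
    exists (T x); apply: sP => // f fs.
    have fi : (index f s < (size s).+1)%N by rewrite ltnS ltnW// index_mem.
    by have := gx (Ordinal fi); rewrite /g /= nth_index.
  split.
  - by exists [::].
  - move=> P Q [s sP] [t tQ]; exists (s ++ t) => x x1 stx.
    by split; [apply: sP|apply: tQ] => // f fs; apply: stx;
      rewrite mem_cat fs ?orbT.
  - move=> P Q PQ [s sP]; exists s => // x x1 fx.
    by apply: PQ; exact: sP.
have FK : F K by exists [::] => // x x1 _; apply: TK; exists x.
have [y [_ yF]] := Kc F FF FK.
exists y; apply/val_inj/funext => f /=.
apply/eqP; rewrite -subr_eq0 -normr_eq0; apply: contraT => d0.
pose d := `|f y - xi (adjoint T f)|.
have {}d0 : 0 < d by rewrite /d normr_gt0 -normr_eq0.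
have e0 : 0 < d / 2 by rewrite divr_gt0.
have fF : F [set z | `|xi (adjoint T f) - f z| < d / 2].
  exists [:: (d / 2)^-1 *: f] => x x1 /(_ _ (mem_head _ _)).
  rewrite linearZ /= linearZ/= -scalerBr normrZ normfV gtr0_norm//.
  by rewrite ltr_pdivrMl// mulr1.
have fy : nbhs (y : weak_topology Y) [set z | `|f y - f z| < d / 2].
  have := @weak_continuous k Y f y _ (nbhsx_ballx (f y) _ e0).
  by rewrite -ball_normE.
(* A common point [z] of both sets would give [|f y - xi (T* f)| < d], against the choice of [d]. *)
have [z [/= fz yz]] := yF _ _ fF fy.
rewrite distrC in fz.
have := ler_distD (f z) (f y) (xi (adjoint T f)).
move=> /le_lt_trans/(_ (ltrD yz fz)).
by rewrite -splitr ltxx.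
Qed.

(** A functional norming [y - z] separates the two points. *)
Lemma canonical_embedding_inj (k : scalars) (Y : normedModType k) :
  injective (@canonical_embedding k Y).
Proof.
move=> y z yz; apply/eqP; rewrite -subr_eq0 -normr_eq0.
have [f [_ <-]] := norming_functional (y - z).
have fyz : f y = f z by exact: (congr1 (fun xi : dual (dual Y) => xi f) yz).
by rewrite raddfB /= fyz subrr.
Qed.

(** Converse of [closure_image_ball]: the bound holds on the image of the ball and passes to the
    closure by continuity of [f]. *)
Lemma closure_image_ball_le (k : scalars) (X Y : normedModType k)
    (T : bounded_op X Y) (u : Y) (f : dual Y) :
  closure (T @` unit_ball X) u -> `|f u| <= `|adjoint T f|.
Proof.
move=> Tu; have Tf0 : 0 <= `|adjoint T f| by exact: opnorm_ge0.
rewrite real_leNgt ?normr_real ?ger0_real//; apply/negP => Tf_lt.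
pose e := `|f u| - `|adjoint T f|.
have e0 : 0 < e by rewrite subr_gt0.
have := @op_continuous _ _ _ f u _ (nbhsx_ballx (f u) _ e0).
rewrite -ball_normE => /Tu[_ [[x x1 <-] /= fux]].
have := ler_distD (f (T x)) (f u) 0; rewrite !subr0.
have Tfx : `|f (T x)| <= `|adjoint T f| by exact: (opnorm_ub (adjoint T f)).
move=> /le_lt_trans/(_ (ltr_leD fux Tfx)).
by rewrite /e subrK ltxx.
Qed.

(** For [f] norming [y], one has [|y| = f y = xi (T* f)]. *)
Lemma biadjoint_bound (k : scalars) (X Y : normedModType k)
    (T : bounded_op X Y) (xi : dual (dual X)) (y : Y) :
  canonical_embedding y = adjoint (adjoint T) xi ->
  `|y| <= `|adjoint T| * `|xi|.
Proof.
move=> yE; have [f [f1 fy]] := norming_functional y.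
have := congr1 (fun eta : dual (dual Y) => eta f) yE.
rewrite /= fy -[X in X <= _]normr_id => ->.
apply: le_trans (le_opnorm xi _) _; rewrite mulrC ler_wpM2r ?opnorm_ge0//.
exact: (opnorm_ub (adjoint T) f1).
Qed.

(** Scaling [xi] to norm 1 reduces existence to [biadjoint_in_range]; injectivity of the embedding
    makes the choice linear, and [biadjoint_bound] makes it bounded. *)
Lemma weakly_compact_biadjoint (k : scalars) (X Y : normedModType k)
    (T : bounded_op X Y) : weakly_compact T ->
  exists S : bounded_op (dual (dual X)) Y, forall xi,
    canonical_embedding (S xi) = adjoint (adjoint T) xi.
Proof.
move=> wT.
have JZ a (y z : Y) : canonical_embedding (a *: y + z) =
    a *: canonical_embedding y + canonical_embedding z.
  by apply/val_inj/funext => f; exact: (linearP f).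
have J0 : canonical_embedding (0 : Y) = 0.
  by apply/val_inj/funext => f; exact: (linear0 f).
have [xi|S SE] := @choice _ _
    (fun xi y => canonical_embedding y = adjoint (adjoint T) xi).
  have [->|xi0] := eqVneq xi 0.
    by exists 0; rewrite linear0.
  have nxi : `|xi| != 0 by rewrite normr_eq0.
  have [|y yE] := @biadjoint_in_range k X Y T (`|xi|^-1 *: xi) wT.
    by rewrite normrZ normfV normr_id mulVf.
  exists (`|xi| *: y).
  by rewrite -[_ *: y]addr0 JZ J0 addr0 yE -linearZ/= scalerA divff// scale1r.
have Sl : linear S.
  move=> a xi eta; apply: canonical_embedding_inj.
  by rewrite JZ !SE linearP.
have Sb : S \in bounded_ops (dual (dual X)) Y.
  apply: (@bounded_opsP _ _ _ _ `|adjoint T|) => // xi.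
  exact: biadjoint_bound.
by exists (BoundedOp Sb).
Qed.

(* In (c), S is T** regarded as an operator from X** to Y. *)
Theorem proposition5p1 (k : scalars) (X Y : completeNormedModType k)
    (T : bounded_op X Y) (hT : weakly_compact T) :
  [<-> QNA T;
       NA (adjoint T);
       exists2 S : bounded_op (dual (dual X)) Y,
         forall xi : dual (dual X),
           canonical_embedding (S xi) = adjoint (adjoint T) xi
         & NA S].
Proof.
have S_le (S : bounded_op (dual (dual X)) Y) :
    (forall xi, canonical_embedding (S xi) = adjoint (adjoint T) xi) ->
    `|S| <= `|adjoint T|.
  move=> SE; apply: opnorm_le => xi xi1.
  apply: le_trans (biadjoint_bound (SE xi)) _.
  by rewrite ler_piMr// opnorm_ge0.
tfae.
(* The chain is [|T*| <= |T| = |u| = |f u| <= |T* f|]. *)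
- move=> [u Tu uT]; have [f [f1 fu]] := norming_functional u.
  exists f => //; apply/le_anti; rewrite opnorm_ub//=.
  apply: le_trans (le_adjoint T) _; rewrite -uT -[leLHS]normr_id -fu.
  exact: closure_image_ball_le.
(* The chain is [|S| <= |T*| = |T* f| = |xi (T* f)| = |f (S xi)| <= |S xi|]. *)
- move=> [f f1 fT]; have [S SE] := weakly_compact_biadjoint hT.
  have [xi [xi1 xif]] := norming_functional (adjoint T f).
  exists S => //; exists xi => //; apply/le_anti; rewrite opnorm_ub//=.
  apply: le_trans (S_le S SE) _; rewrite -fT -normr_id -xif.
  have <- : f (S xi) = xi (adjoint T f).
    exact: (congr1 (fun eta : dual (dual Y) => eta f) (SE xi)).
  by rewrite (le_trans (le_opnorm f _))// ler_piMl.
- move=> [S SE [xi xi1 xiS]]; exists (S xi).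
    apply: closure_image_ball => f.
    have -> : f (S xi) = xi (adjoint T f).
      exact: (congr1 (fun eta : dual (dual Y) => eta f) (SE xi)).
    by rewrite (le_trans (le_opnorm _ _))// ler_piMl.
  (* It remains to see [|S| = |T|]: [S] extends [T] along the canonical embedding, which maps the
     unit ball of [X] into that of the bidual. *)
  rewrite xiS; apply/le_anti/andP; split.
    exact: le_trans (S_le S SE) (le_adjoint T).
  apply: opnorm_le => x x1.
  have <- : S (canonical_embedding x) = T x.
    by apply: canonical_embedding_inj; rewrite SE; apply/val_inj/funext.
  apply: opnorm_ub; apply: opnorm_le => f f1.
  rewrite /=; apply: le_trans (le_opnorm f x) _.
  by rewrite (le_trans (ler_piMr _ x1)) ?opnorm_ge0.
Qed.
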